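(* Let $G=\mathbb{Z}_{n_1}\oplus\cdots\oplus\mathbb{Z}_{n_k}$ be a finite abelian group of order $n=n_1\cdots n_k$, enumerated as $G=\{a_0,\ldots,a_{n-1}\}$ with $a_0=0$, and let $S\subseteq G\setminus\{0\}$ with $S=-S$. Let $a,b$ be two distinct vertices of $\mathrm{Cay}(G,S)$, let $\lambda_r=\sum_{y\in S}\chi_r(y)$ for $0\le r\le n-1$, and let $X_2=\{r: 0\le r\le n-1,\ \chi_r(b-a)=-1\}$. Then $\mathrm{Cay}(G,S)$ exhibits PGFR between $a$ and $b$ if and only if both of the following hold: (i) $n$ is even and $b-a$ is an element of order two; (ii) for arbitrary integers $\ell_1,\ldots,\ell_{n-1}$, the relation $\sum_{r=1}^{n-1}\ell_r(\lambda_r-\lambda_0)=0$ implies $\sum_{r\in X_2}\ell_r\neq\pm1$.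
   Context: For a finite abelian group $G$ (written additively) and $S\subseteq G\setminus\{0\}$ with $S=-S$, the Cayley graph $\mathrm{Cay}(G,S)$ has vertex set $G$, two distinct vertices $a,b$ being adjacent iff $b-a\in S$. For $a_r=(g_{1r},\ldots,g_{kr})\in G$, the character $\chi_r$ is defined by $\chi_r(a_\ell)=\prod_{j=1}^k\omega_{n_j}^{g_{jr}g_{j\ell}}$ where $\omega_{n_j}=\exp(2\pi\mathbf{i}/n_j)$; the numbers $\lambda_r$ are the eigenvalues of $\mathrm{Cay}(G,S)$. For a graph $\Gamma$ with adjacency matrix $A$, the transition matrix is $H(t)=\exp(-\mathbf{i}tA)$, $t\in\mathbb{R}$, and $\mathbf{e}_v$ denotes the standard basis vector of vertex $v$. $\Gamma$ exhibits pretty good fractional revival (PGFR) between distinct vertices $a$ and $b$ if there is a sequence of real numbers $\{t_k\}$ with $\lim_{k\to\infty}H(t_k)\mathbf{e}_a=\alpha\mathbf{e}_a+\beta\mathbf{e}_b$ for some $\alpha,\beta\in\mathbb{C}$ with $\beta\neq0$ and $|\alpha|^2+|\beta|^2=1$. *)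

(* Defs.v *)
From HB Require Import structures.
From mathcomp Require Import all_boot all_order all_algebra all_fingroup.
From mathcomp Require Import complex.
From mathcomp Require Import all_classical all_reals.
From mathcomp Require Import topology normedtype sequences trigo.

Set Implicit Arguments.
Unset Strict Implicit.
Unset Printing Implicit Defensive.

Import Order.TTheory GRing.Theory Num.Theory.
Import numFieldNormedType.Exports.

Local Open Scope ring_scope.
Local Open Scope classical_set_scope.

(* R[i] gets the topology of its modulus, through the regular module R[i]^o. *)
HB.instance Definition _ (R : realType) := NormedModule.copy R[i] R[i]^o.

(* For 0 < n this is Z/nZ with carrier {0, ..., n - 1}. Unlike 'Z_n, it is the
   trivial group for n = 1. *)
Definition Zmod (n : nat) : finZmodType := 'I_n.-1.+1.

(* Z_{n_1} (+) ... (+) Z_{n_k}. The alias hides the multiplicative group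
   structure that the library puts on {dffun _}. *)
Definition dirsum (k : nat) (n : 'I_k -> nat) : Type :=
  {dffun forall j : 'I_k, Zmod (n j)}.

Section DirectSum.
Variables (k : nat) (n : 'I_k -> nat).
Local Notation G := (dirsum n).
Implicit Types x y z : G.

HB.instance Definition _ := Finite.copy G {dffun forall j : 'I_k, Zmod (n j)}.

Definition dirsum0 : G := [ffun j => 0 : Zmod (n j)].
Definition dirsumN x : G := [ffun j => - x j].
Definition dirsumD x y : G := [ffun j => x j + y j].

Fact dirsumDA : associative dirsumD.
Proof. by move=> x y z; apply/ffunP => j; rewrite !ffunE addrA. Qed.

Fact dirsumDC : commutative dirsumD.
Proof. by move=> x y; apply/ffunP => j; rewrite !ffunE addrC. Qed.

Fact dirsum0D : left_id dirsum0 dirsumD.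
Proof. by move=> x; apply/ffunP => j; rewrite !ffunE add0r. Qed.

Fact dirsumND : left_inverse dirsum0 dirsumN dirsumD.
Proof. by move=> x; apply/ffunP => j; rewrite !ffunE addNr. Qed.

HB.instance Definition _ :=
  GRing.isZmodule.Build G dirsumDA dirsumDC dirsum0D dirsumND.
HB.instance Definition _ := [finGroupMixin of G for +%R].

End DirectSum.

(* exp(i x) for real x *)
Definition expi (R : realType) (x : R) : R[i] := Complex (cos x) (sin x).

Definition omega (R : realType) (m : nat) : R[i] := expi (2 * pi / m%:R).

(* The character attached to g, evaluated at h; g j and h j are the
   representatives in {0, ..., n_j - 1}. *)
Definition chi (R : realType) (k : nat) (n : 'I_k -> nat) (g h : dirsum n) :
  R[i] := \prod_(j < k) omega R (n j) ^+ (val (g j) * val (h j)).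

Definition cayley (G : finZmodType) (S : {set G}) : rel G :=
  [rel a b | (a != b) && (b - a \in S)].

Section Graph.
Variables (R : realType) (T : finType) (e : rel T).

(* Rows and columns are indexed by the positions in the enumeration of T. *)
Definition adjmx : 'M[R[i]]_#|T| :=
  \matrix_(i, j) (e (enum_val i) (enum_val j))%:R.

Definition evec (v : T) : 'cV[R[i]]_#|T| := delta_mx (enum_rank v) 0.

End Graph.

(* The exponential series converges for every A, so limn never falls back to its
   default value. *)
Definition expmx (R : realType) (m : nat) (A : 'M[R[i]]_m) : 'M[R[i]]_m :=
  limn (series (fun p : nat => (p`!%:R : R[i])^-1 *: A ^+ p)).

Definition transmx (R : realType) (T : finType) (e : rel T) (t : R) :
  'M[R[i]]_#|T| := expmx ((- ('i * t%:C%C)) *: adjmx R e).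

Definition PGFR (R : realType) (T : finType) (e : rel T) (a b : T) : Prop :=
  exists (t : nat -> R) (alpha beta : R[i]),
    [/\ (fun p => transmx e (t p) *m evec R a) @ \oo -->
          alpha *: evec R a + beta *: evec R b,
        beta != 0
      & `|alpha| ^+ 2 + `|beta| ^+ 2 = 1].

(* Main.v *)
(** The operator H(t) is diagonalised by the characters, with eigenvalues
    exp(-i t lambda_g), so by Fourier inversion revival between [a] and [b] along
    (t_p) means exp(-i t_p lambda_g) -> alpha + beta chi_g(a - b) for all g.
    - If this holds, lambda_(-g) = lambda_g makes every chi_g(b - a) real, whence
      2(b - a) = 0. The limits are then alpha - beta on [X2] and alpha + beta
      elsewhere, all of modulus 1, so a relation between the lambda_r - lambda_0
      gives zeta^(sum over [X2]) = 1 with zeta = (alpha - beta) / (alpha + beta),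
      and zeta <> 1 because beta <> 0.
    - Conversely the integers [\sum_(r in X2) l r] attached to the relations form
      a subgroup of Z without 1, hence share a divisor d >= 2. Prescribing the
      phase exp(2 i pi / d) on [X2] and 1 elsewhere (up to a common factor, which
      compactness of the circle lets converge) respects all relations, so
      Kronecker's approximation theorem provides the times t_p.
    Kronecker's theorem is proved by Bohr's method: if the exponential sum
    f(t) = sum_i z_i exp(i t mu_i) stayed below n / (1 + h) in modulus, then the
    Fourier coefficients of f^p would be at most (n / (1 + h))^p; but f^p has n^p
    unimodular terms and at most (p + 1)^n frequencies, and terms of equal
    frequency have equal coefficients, so some Fourier coefficient is at least
    n^p / (p + 1)^n. *)

Require Import Defs.
From mathcomp Require Import all_boot all_order all_algebra all_fingroup.
From mathcomp Require Import cyclic complex.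
From mathcomp Require Import all_classical all_reals.
From mathcomp Require Import topology normedtype sequences trigo.
From mathcomp Require Import ring lra.

Import Order.TTheory GRing.Theory Num.Theory.
Import numFieldNormedType.Exports.

Set Implicit Arguments.
Unset Strict Implicit.
Unset Printing Implicit Defensive.

Local Open Scope ring_scope.

(** * Exponentials and growth *)

Lemma expi0 (R : realType) : expi (0 : R) = 1.
Proof. by rewrite /expi cos0 sin0. Qed.

Lemma expiD (R : realType) (x y : R) : expi (x + y) = expi x * expi y.
Proof.
by apply/eqP; rewrite eq_complex /= cosD sinD; apply/andP; split; apply/eqP; ring.
Qed.

Lemma norm_expi (R : realType) (x : R) : `|expi x| = 1.
Proof. by rewrite normc_def /= cos2Dsin2 sqrtr1. Qed.

Lemma expi_neq0 (R : realType) (x : R) : expi x != 0.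
Proof. by rewrite -normr_eq0 norm_expi oner_eq0. Qed.

Lemma expiN (R : realType) (x : R) : expi (- x) = (expi x)^-1.
Proof.
by apply: (mulfI (expi_neq0 x)); rewrite -expiD subrr expi0 divff ?expi_neq0.
Qed.

Lemma expiMn (R : realType) (x : R) (m : nat) : expi (x *+ m) = expi x ^+ m.
Proof. by elim: m => [|m IH]; rewrite ?expi0 // mulrS expiD IH exprS. Qed.

Lemma expi_sum (R : realType) (I : finType) (x : I -> R) :
  expi (\sum_i x i) = \prod_i expi (x i).
Proof. by apply: (big_morph (@expi R)); [exact: expiD | exact: expi0]. Qed.

(** By the half-angle formula cos x = 1 forces sin (x / 2) = 0, but x / 2 would lie strictly between
    0 and pi if x were positive. *)
Lemma expi_eq1 (R : realType) (x : R) : `|x| < 2 * pi -> expi x = 1 -> x = 0.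
Proof.
wlog x_ge0 : x / 0 <= x => [H|].
  have [/H//|x_lt0] := leP 0 x; rewrite -normrN => xpi x1.
  apply: oppr_inj; rewrite oppr0; apply: H => //; first by rewrite oppr_ge0 ltW.
  by rewrite expiN x1 invr1.
rewrite ger0_norm // => xpi [cosx _].
have [//|x_neq0] := eqVneq x 0; exfalso.
have x_gt0 : 0 < x by rewrite lt0r x_neq0.
have: 0 < sin (x / 2).
  apply: sin_gt0_pi; move: pi_gt0 xpi => /(_ R); lra.
have: cos (x / 2 *+ 2) = 1.
  by rewrite -mulr_natr divfK ?pnatr_eq0.
rewrite cos_mulr2n cos2sin2 => c s_gt0.
have: sin (x / 2) ^+ 2 = 0 by move: c; rewrite mulr2n => c; lra.
by move/eqP; rewrite sqrf_eq0 gt_eqF.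
Qed.

(** Multiplying by w - 1 telescopes the sum. The bound does not depend on [M], so averaging over [M]
    samples makes such sums negligible. *)
Lemma norm_geometric_sum (C : numFieldType) (w : C) (M : nat) :
  `|w| = 1 -> w != 1 -> `|\sum_(s < M) w ^+ s| <= 2 / `|w - 1|.
Proof.
move=> w1 w_neq1; rewrite ler_pdivlMr ?normr_gt0 ?subr_eq0 //.
rewrite -normrM mulrC -subrX1 (le_trans (ler_normB _ _)) //.
by rewrite normrX w1 expr1n normr1.
Qed.

(** For p = x (m + 1) and h <= 1, Bernoulli gives (1 + h)^p >= (h (x + 1))^(m + 1), which has one
    degree in x more than (p + 1)^m <= ((m + 1) (x + 1))^m. *)
Lemma poly_lt_exp (R : archiRealFieldType) (h : R) (m : nat) :
  0 < h -> exists p : nat, p.+1%:R ^+ m < (1 + h) ^+ p.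
Proof.
wlog h_le1 : h / h <= 1 => [H h_gt0|h_gt0].
  have [/H/(_ h_gt0)//|h_gt1] := leP h 1.
  have [p Hp] := H 1 (lexx _) ltr01; exists p; apply: lt_le_trans Hp _.
  by apply: lerXn2r; rewrite ?nnegrE; lra.
(* Once x + 1 exceeds [B], the power of degree m + 1 dominates the one of degree m. *)
set B := m.+1%:R ^+ m / h ^+ m.+1.
have B_ge0 : 0 <= B by rewrite divr_ge0 ?exprn_ge0 ?ltW.
pose x := Num.bound B; exists (x * m.+1)%N.
have xB : B < x.+1%:R.
  by rewrite (lt_trans (archi_boundP B_ge0)) // ltr_nat.
apply: (@lt_le_trans _ _ ((h * x.+1%:R) ^+ m.+1)); last first.
  have h1 : 0 <= 1 + h by lra.
  have hx : 0 <= h * x.+1%:R by rewrite mulr_ge0 // ltW.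
  rewrite exprM; apply: lerXn2r; rewrite ?nnegrE ?exprn_ge0 //.
  have bern : forall y, 1 + h * y%:R <= (1 + h) ^+ y.
    elim=> [|y IH]; first by rewrite mulr0 addr0.
    rewrite exprS -natr1; apply: le_trans (ler_wpM2l _ IH); last by lra.
    have := ler0n R y; nra.
  apply: le_trans (bern x).
  by rewrite -natr1 mulrDr mulr1; lra.
apply: (@le_lt_trans _ _ ((m.+1 * x.+1)%:R ^+ m)).
  apply: lerXn2r; rewrite ?nnegrE ?ler0n // ler_nat mulnC.
  by rewrite mulnS ltnS mulnC leq_addl.
move: xB; rewrite ltr_pdivrMr ?exprn_gt0 // => xB.
rewrite natrM !exprMn [X in _ < _ * X]exprS mulrA ltr_pM2r ?exprn_gt0 //.
by rewrite [ltRHS]mulrC.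
Qed.

(** * Kronecker's theorem *)

(** A largest fibre is at least as large as the average one; [t0] provides a point at which to start
    the maximisation. *)
Lemma pigeonhole_fibre (T U : finType) (f : T -> U) (t0 : T) :
  exists t, (#|T| <= #|U| * #|[set t' | f t' == f t]|)%N.
Proof.
case: (@arg_maxnP T t0 xpredT (fun t => #|[set t' | f t' == f t]|) isT) => t _ t_max.
exists t; rewrite -[leqLHS]sum1_card (partition_big f xpredT) //=.
set m := #|[set _ | _]|; have -> : (#|U| * m = \sum_(u : U) m)%N.
  by rewrite sum_nat_const.
apply: leq_sum => u _; rewrite sum1_card.
have [[t' /eqP ft']|noF] := pselect (exists t', f t' == u).
  rewrite -ft'; apply: leq_trans (t_max t' isT).
  by rewrite subset_leq_card //; apply/fintype.subsetP => x; rewrite !inE.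
by rewrite eq_card0 // => t'; apply/negP => ft'; apply: noF; exists t'.
Qed.

Lemma archi_affine_le (R : archiRealFieldType) (a b c : R) :
  (forall M : nat, M%:R * a <= M%:R * b + c) -> a <= b.
Proof.
move=> H; rewrite leNgt; apply/negP => ltba.
have c_ge0 : 0 <= c by have := H 0%N; rewrite !mul0r add0r.
have ab : 0 < a - b by rewrite subr_gt0.
have := archi_boundP (divr_ge0 c_ge0 (ltW ab)).
rewrite ltr_pdivrMr //; have := H (Num.bound (c / (a - b))).
by rewrite mulrBr => /[swap]; lra.
Qed.

(** * Bohr's lower bound for exponential sums *)

Section Bohr.
Variables (R : realType) (I : finType) (mu : I -> R) (z : I -> R[i]).
Hypothesis norm_z : forall i, `|z i| = 1.
(* z extends to a character of the group generated by the frequencies, on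
   relations of total weight 0. *)
Hypothesis z_compat : forall c c' : I -> nat,
  (\sum_i c i = \sum_i c' i)%N -> \sum_i mu i *+ c i = \sum_i mu i *+ c' i ->
  \prod_i z i ^+ c i = \prod_i z i ^+ c' i.

Let f t := \sum_i z i * expi (t * mu i).

Section Power.
Variables (p : nat) (i0 : I).
Local Notation J := {ffun 'I_p -> I}.
(** Expanding f^p gives one term per [g]: [nu g] is its frequency, [zeta g] its coefficient, and
    [count g] the exponents of the corresponding monomial. *)
Let nu (g : J) := \sum_j mu (g j).
Let zeta (g : J) := \prod_j z (g j).
Let count (g : J) i := #|[set j | g j == i]|.

Let sum_count (T : nmodType) (h : I -> T) (g : J) :
  \sum_j h (g j) = \sum_i h i *+ count g i.
Proof.
rewrite (partition_big g xpredT) //=; apply: eq_bigr => i _.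
rewrite -sumr_const; apply: eq_big => [j|j /eqP -> //].
by rewrite inE.
Qed.

Let prod_count (g : J) : zeta g = \prod_i z i ^+ count g i.
Proof.
rewrite /zeta (partition_big g xpredT) //=; apply: eq_bigr => i _.
rewrite -prodr_const; apply: eq_big => [j|j /eqP -> //].
by rewrite inE.
Qed.

Let sum_countE (g : J) : (\sum_i count g i = p)%N.
Proof.
have := @sum_count nat (fun=> 1%N) g; rewrite sum1_card card_ord => ->.
by apply: eq_bigr => i _; rewrite natn.
Qed.

Let nu_count (g g' : J) : count g =1 count g' -> nu g = nu g'.
Proof. by move=> gg'; rewrite /nu !sum_count; apply: eq_bigr => i _; rewrite gg'. Qed.

(** This is where [z_compat] enters: both count vectors have total weight [p]. *)
Let nu_zeta (g g' : J) : nu g = nu g' -> zeta g = zeta g'.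
Proof.
move=> gg'; rewrite !prod_count; apply: z_compat; first by rewrite !sum_countE.
by rewrite -!sum_count.
Qed.

Let norm_zeta g : `|zeta g| = 1.
Proof. by rewrite normr_prod big1. Qed.

Let f_exp t : f t ^+ p = \sum_(g : J) zeta g * expi (t * nu g).
Proof.
rewrite -[p in LHS]card_ord -prodr_const bigA_distr_bigA /=.
apply: eq_bigr => g _; rewrite big_split /=; congr (_ * _).
by rewrite mulr_sumr expi_sum.
Qed.

(** A small enough step [delta] keeps all phases delta (nu g - nu g0) inside (-2 pi, 2 pi), where
    only 0 has exponential 1. Time averages can then be taken over the multiples of [delta]. *)
Let sampling (g0 : J) : exists delta : R, forall g,
  nu g != nu g0 -> expi (delta * (nu g - nu g0)) != 1.
Proof.
pose D := 1 + \sum_g `|nu g - nu g0|.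
have D_gt0 : 0 < D by rewrite ltr_wpDr // sumr_ge0.
exists D^-1 => g; apply: contraNneq => /expi_eq1 H.
suff /H/eqP : `|D^-1 * (nu g - nu g0)| < 2 * pi.
  by rewrite mulf_eq0 invr_eq0 gt_eqF //= subr_eq0.
rewrite normrM gtr0_norm ?invr_gt0 // mulrC ltr_pdivrMr //.
apply: (@lt_le_trans _ _ D).
  rewrite /D (bigD1 g) //= ltr_pwDl // lerDl sumr_ge0 //.
rewrite ler_peMl ?ltW //; have := pi_ge2 R; lra.
Qed.

(* Averaging f^p against the character of frequency nu g0 isolates the terms of
   that frequency, which all have the same coefficient. *)
Let fibre_le (F : R) (g0 : J) : (forall t, `|f t| <= F%:C%C) ->
  #|[set g | nu g == nu g0]|%:R <= F ^+ p.
Proof.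
move=> f_le; have [delta delta_ok] := sampling g0.
set m := #|_|.
pose w (g : J) := expi (delta * (nu g - nu g0)).
(* [K] bounds the contribution of all other frequencies, uniformly in the number [M] of samples. *)
pose K := \sum_(g | nu g != nu g0) 2 / `|w g - 1|.
have K_real : K = (complex.Re K)%:C%C.
  rewrite RRe_real // ger0_real // sumr_ge0 // => g _.
  by rewrite divr_ge0.
apply: (@archi_affine_le _ _ _ (complex.Re K)) => M.
have shift s g : expi (delta * s%:R * nu g) * expi (- (delta * s%:R * nu g0)) = w g ^+ s.
  by rewrite -expiD -expiMn; congr expi; ring.
have : \sum_(s < M) f (delta * s%:R) ^+ p * expi (- (delta * s%:R * nu g0)) =
   zeta g0 * (M%:R * m%:R) + \sum_(g | nu g != nu g0) zeta g * \sum_(s < M) w g ^+ s.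
  under eq_bigr => s _.
    rewrite f_exp mulr_suml.
    under eq_bigr => g _ do rewrite -mulrA shift.
    over.
  rewrite exchange_big /= (bigID (fun g => nu g == nu g0)) /=; congr (_ + _).
    under eq_bigr => g /eqP gg0.
      rewrite (nu_zeta gg0) -mulr_sumr /w gg0 subrr mulr0 expi0.
      under eq_bigr do rewrite expr1n.
      rewrite sumr_const card_ord.
      over.
    rewrite sumr_const -mulrnAr -mulr_natr; congr (_ * (_ * _)).
    by congr (_%:R); apply: eq_card => g; rewrite !inE.
  by apply: eq_bigr => g _; rewrite mulr_sumr.
(* Isolating the main term, of modulus M m, gives M m <= M F^p + K; letting M grow yields the
   claim. *)
move=> /(congr1 (fun x => x - \sum_(g | nu g != nu g0) zeta g * \sum_(s < M) w g ^+ s)).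
rewrite addrK => /(congr1 (fun x => `|x|)).
rewrite normrM norm_zeta mul1r normrM !normr_nat => E.
rewrite -lecR !rmorphD !rmorphM /= !rmorphXn /= !rmorph_nat -K_real -E.
rewrite (le_trans (ler_normB _ _)) // lerD //.
  rewrite (le_trans (ler_norm_sum _ _ _)) //.
  rewrite mulr_natl -[X in _ <= _ *+ X]card_ord -sumr_const; apply: ler_sum => s _.
  rewrite normrM norm_expi mulr1 normrX.
  by apply: lerXn2r; rewrite ?nnegrE // (le_trans _ (f_le 0)).
rewrite (le_trans (ler_norm_sum _ _ _)) //; apply: ler_sum => g g_neq.
rewrite normrM norm_zeta mul1r norm_geometric_sum ?norm_expi //.
exact: delta_ok.
Qed.

(** The n^p choice functions share at most (p + 1)^n count vectors. A largest fibre lies within a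
    single frequency class, whose size is at most F^p. *)
Lemma bohr_bound (F : R) : (forall t, `|f t| <= F%:C%C) ->
  #|I|%:R ^+ p <= p.+1%:R ^+ #|I| * F ^+ p.
Proof.
move=> f_le.
pose cnt (g : J) : {ffun I -> 'I_p.+1} := [ffun i => inord (count g i)].
have cntE g i : cnt g i = count g i :> nat.
  rewrite ffunE inordK // ltnS -[leqRHS]card_ord; exact: max_card.
have [g0] := pigeonhole_fibre cnt [ffun=> i0].
rewrite !card_ffun !card_ord => le_fib.
rewrite -!natrX; apply: (@le_trans _ _ (p.+1 ^ #|I| * #|[set g | nu g == nu g0]|)%:R).
  rewrite ler_nat (leq_trans le_fib) // leq_mul2l subset_leq_card ?orbT //.
  apply/fintype.subsetP => g; rewrite !inE => /eqP gg0; apply/eqP/nu_count => i.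
  by rewrite -!cntE gg0.
by rewrite natrM ler_wpM2l // fibre_le.
Qed.

End Power.

Lemma bohr_sup (i0 : I) (h : R) : 0 < h -> exists t, (#|I|%:R / (1 + h))%:C%C < `|f t|.
Proof.
move=> h_gt0; apply/not_existsP => H.
have h1 : 0 < 1 + h by rewrite addr_gt0.
have I_gt0 : 0 < #|I|%:R :> R by rewrite ltr0n; apply/card_gt0P; exists i0.
have [p p_lt] := poly_lt_exp #|I| h_gt0.
suff: #|I|%:R ^+ p <= p.+1%:R ^+ #|I| * (#|I|%:R / (1 + h)) ^+ p :> R.
  rewrite expr_div_n mulrA ler_pdivlMr ?exprn_gt0 // [leRHS]mulrC.
  by rewrite ler_pM2l ?exprn_gt0 // leNgt p_lt.
apply: bohr_bound => // t; have /negP := H t.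
rewrite -real_leNgt // ?normr_real //.
by apply/complex_realP; eexists.
Qed.

End Bohr.

(** The modulus takes values in [R[i]]; this lets inequalities between moduli be treated in [R]. *)
Lemma norm_complexP (R : realType) (x : R[i]) : exists2 r : R, 0 <= r & `|x| = r%:C%C.
Proof.
have xE : `|x| = (complex.Re `|x|)%:C%C by rewrite RRe_real ?normr_real.
by exists (complex.Re `|x|); rewrite // -lecR -xE normr_ge0.
Qed.

(** By the parallelogram law, |u + v|^2 <= 4 - e^2 <= (2 - e^2 / 4)^2. *)
Lemma norm_add_unit_le (R : realType) (u v : R[i]) (e : R) :
  `|u| = 1 -> `|v| = 1 -> 0 <= e -> e%:C%C <= `|u - v| -> `|u + v| <= (2 - e ^+ 2 / 4)%:C%C.
Proof.
move=> u1 v1 e_ge0.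
have parallelogram : `|u + v| ^+ 2 + `|u - v| ^+ 2 = 2 * (`|u| ^+ 2 + `|v| ^+ 2).
  by rewrite !sqr_normc !rmorphD !rmorphN /=; ring.
have : `|u - v| <= `|u| + `|v| by rewrite ler_normB.
move: parallelogram; rewrite u1 v1.
have [A A_ge0 ->] := norm_complexP (u + v).
have [B B_ge0 ->] := norm_complexP (u - v).
have -> : (1 + 1 : R[i]) = 2%:C%C by rewrite -[2]/(1 + 1) rmorphD.
have -> : (2 * (1 ^+ 2 + 1 ^+ 2) : R[i]) = 4%:C%C.
  by rewrite !rmorph_nat; ring.
rewrite -!rmorphXn -rmorphD /= => /complexI AB; rewrite !lecR => B2 eB.
have eB2 : e * e <= B * B by rewrite ler_pM.
(* This makes 2 - e^2 / 4 nonnegative, so that the squares can be compared. *)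
have e4 : e * e <= 4.
  by have : e * e <= 2 * 2; [rewrite ler_pM // (le_trans eB) | lra].
rewrite leNgt; apply/negP => lt_A; rewrite !expr2 in AB lt_A.
have : (2 - e * e / 4) * (2 - e * e / 4) < A * A by rewrite ltr_pM //; lra.
have := sqr_ge0 (e * e); rewrite expr2; nra.
Qed.

Section Kronecker.
Local Open Scope classical_set_scope.
Variables (R : realType) (I : finType) (mu : I -> R) (z : I -> R[i]).
Hypothesis norm_z : forall i, `|z i| = 1.
Hypothesis z_compat : forall c c' : I -> nat,
  (\sum_i c i = \sum_i c' i)%N -> \sum_i mu i *+ c i = \sum_i mu i *+ c' i ->
  \prod_i z i ^+ c i = \prod_i z i ^+ c' i.

Let w i t := z i * expi (t * mu i).

(** If two of the unit terms differ by at least [e], the modulus of their sum drops by e^2 / 4 below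
    n, against Bohr's lower bound. The terms are only compared with each other, since a common phase
    stays free. *)
Lemma kronecker (i0 : I) (e : R) : 0 < e ->
  exists t, forall i j, `|w i t - w j t| < e%:C%C.
Proof.
move=> e_gt0; set n : R := #|I|%:R.
have n_gt0 : 0 < n by rewrite ltr0n; apply/card_gt0P; exists i0.
(* With h = E / n and E = e^2 / 4 one has n / (1 + h) >= n - E, because (n - E) (1 + E / n) = n -
   E^2 / n. *)
have h_gt0 : 0 < e ^+ 2 / 4 / n by rewrite !divr_gt0 // exprn_gt0.
have [t t_lt] := bohr_sup norm_z z_compat i0 h_gt0.
exists t => i j; rewrite real_ltNge ?normr_real //; last first.
  by apply/complex_realP; eexists.
apply/negP => wij.
have norm_w k : `|w k t| = 1 by rewrite normrM norm_z norm_expi mulr1.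
have ji : j != i.
  apply/eqP => ji; move: wij.
  by rewrite ji subrr normr0 -(rmorph0 (real_complex R)) lecR leNgt e_gt0.
have : `|\sum_i z i * expi (t * mu i)| <= (n - e ^+ 2 / 4)%:C%C.
  have -> : (n - e ^+ 2 / 4)%:C%C = (2 - e ^+ 2 / 4)%:C%C + \sum_(k | (k != i) && (k != j)) 1.
    have : \sum_(k : I) 1 = n by rewrite sumr_const.
    rewrite (bigD1 i) // (bigD1 j) //= => <-.
    have -> : \sum_(k | (k != i) && (k != j)) (1 : R[i]) =
        (\sum_(k | (k != i) && (k != j)) 1)%:C%C.
      by rewrite rmorph_sum.
    by rewrite -rmorphD; congr (_%:C)%C; ring.
  rewrite (bigD1 i) // (bigD1 j) //= addrA (le_trans (ler_normD _ _)) // lerD //.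
    exact: (norm_add_unit_le (norm_w i) (norm_w j) (ltW e_gt0)).
  by rewrite (le_trans (ler_norm_sum _ _ _)) // ler_sum // => k _; rewrite norm_w.
move=> /(lt_le_trans t_lt); rewrite ltcR ltNge => /negP; apply.
rewrite ler_pdivlMr; last by rewrite addr_gt0.
have : 0 <= (e ^+ 2 / 4 ) ^+ 2 / n by rewrite divr_ge0 ?sqr_ge0 // ltW.
have nV : n / n = 1 by rewrite divff // gt_eqF.
rewrite expr2; set E := e ^+ 2 / 4.
have -> : (n - E) * (1 + E / n) = n - E * E / n + E * (n / n) - E by ring.
by rewrite nV; lra.
Qed.
End Kronecker.

(** * Complex limits and compactness of the circle *)

Section ComplexLimits.
Local Open Scope classical_set_scope.
Variables (R : realType) (T : Type) (F : set_system T).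
Hypothesis FF : Filter F.

Lemma cvg_real_complex (f : T -> R) (l : R) :
  f @ F --> l -> (f x)%:C%C @[x --> F] --> l%:C%C.
Proof.
move=> /cvgrPdist_lt fl; apply/cvgrPdist_lt => e e_gt0.
have eE : e = (complex.Re e)%:C%C by rewrite RRe_real // gtr0_real.
have := fl (complex.Re e); rewrite -ltcR -eE => /(_ e_gt0).
apply: filterS => x; rewrite -rmorphB /= normc_def /= expr0n addr0 sqrtr_sqr.
by rewrite eE ltcR.
Qed.

Lemma cvg_complex (f g : T -> R) (l m : R) : f @ F --> l -> g @ F --> m ->
  Complex (f x) (g x) @[x --> F] --> Complex l m.
Proof.
move=> fl gm.
have E (a b : R) : Complex a b = a%:C%C + 'i%C * b%:C%C.
  by rewrite [LHS]complexE.
rewrite E; under eq_fun do rewrite E.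
apply: cvgD; first exact: cvg_real_complex.
by apply: cvgMl_tmp; exact: cvg_real_complex.
Qed.
End ComplexLimits.

Lemma norm_complex_le (R : realType) (x : R[i]) :
  `|x| <= (`|complex.Re x| + `|complex.Im x|)%:C%C.
Proof.
rewrite normc_def lecR -(@ler_sqr R) ?nnegrE ?sqrtr_ge0 ?addr_ge0 //.
rewrite sqr_sqrtr ?addr_ge0 ?sqr_ge0 // sqrrD !real_normK ?num_real //.
by rewrite lerD2r lerDl mulrn_wge0 // mulr_ge0.
Qed.

(** Bolzano-Weierstrass in the square [-1, 1]^2, applied to real and imaginary parts; the cluster
    point has modulus 1 because it is approximated by points of modulus 1. *)
Lemma circle_cluster (R : realType) (u : nat -> R[i]) : (forall p, `|u p| = 1) ->
  exists2 w, `|w| = 1 &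
    forall (e : R) p, 0 < e -> exists2 q, (p <= q)%N & `|u q - w| < e%:C%C.
Proof.
move=> norm_u.
pose x p := (complex.Re (u p), complex.Im (u p)).
pose A := (`[-1, 1] `*` `[-1, 1])%classic : set (R * R).
have A_compact : compact A by apply: compact_setX; exact: segment_compact.
have xA p : A (x p).
  have : (complex.Re (u p)) ^+ 2 + (complex.Im (u p)) ^+ 2 = 1.
    by apply: complexI; rewrite add_Re2_Im2 norm_u expr1n.
  by split; rewrite /= in_itv /=; apply/andP; split; nra.
have [|[c d] [_ cl]] := A_compact (x @ \oo)%classic _.
  by apply: (@filterE _ \oo%classic) => p; exact: xA.
have near_w (e : R) p : 0 < e ->
    exists2 q, (p <= q)%N & `|u q - Complex c d| < e%:C%C.
  move=> e_gt0; have e2 : 0 < e / 2 by rewrite divr_gt0.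
  have [] := cl (x @` [set q | (p <= q)%N])%classic
    (ball c (e / 2) `*` ball d (e / 2))%classic.
  - by exists p => // q pq; exists q.
  - by exists (ball c (e / 2), ball d (e / 2)) => //; split; exact: nbhsx_ballx.
  move=> _ [[q pq <-] [/= cq dq]]; exists q => //.
  apply: le_lt_trans (norm_complex_le _) _; rewrite ltcR.
  move: cq dq; rewrite /ball /= => cq dq.
  case: (u q) cq dq => a b /= cq dq.
  by rewrite distrC [X in _ + X]distrC [ltRHS]splitr ltrD.
exists (Complex c d) => //.
have [r r_ge0 wr] := norm_complexP (Complex c d).
rewrite wr; congr (_%:C)%C; apply/eqP; rewrite eq_sym -subr_eq0 -normr_le0.
apply/ler_addgt0Pl => e e_gt0; rewrite addr0.
have [q _ uq] := near_w e 0%N e_gt0.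
have := le_lt_trans (lerB_dist _ _) uq.
have := le_lt_trans (lerB_dist _ _) (etrans (congr1 (fun x => x < _) (distrC _ _)) uq).
rewrite norm_u wr -(rmorph1 (real_complex R)) -!rmorphB !ltcR => h1 h2.
by rewrite ler_norml; lra.
Qed.

(** * Kronecker's theorem along a sequence of times *)

Section KroneckerSequence.
Local Open Scope classical_set_scope.
Variables (R : realType) (I : finType) (mu : I -> R) (z : I -> R[i]).
Hypothesis norm_z : forall i, `|z i| = 1.
Hypothesis z_compat : forall c c' : I -> nat,
  (\sum_i c i = \sum_i c' i)%N -> \sum_i mu i *+ c i = \sum_i mu i *+ c' i ->
  \prod_i z i ^+ c i = \prod_i z i ^+ c' i.

Lemma kronecker_seq (i0 : I) : exists (t : nat -> R) (w : R[i]),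
  `|w| = 1 /\ forall i, (fun p => z i * expi (t p * mu i)) @ \oo --> w.
Proof.
pose e p : R := p.+1%:R^-1.
have e_gt0 p : 0 < e p by rewrite invr_gt0.
have [s s_lt] := choice (fun p => kronecker norm_z z_compat i0 (e_gt0 p)).
have [|w w1 cl] := @circle_cluster R (fun p => z i0 * expi (s p * mu i0)).
  by move=> p; rewrite normrM norm_z norm_expi mulr1.
(* At time s (q p) the phase of [i0] is close to [w] and all phases are close to that of [i0], each
   up to 1 / (p + 1). *)
have /choice[q q_lt] p : exists q, (p <= q)%N /\ `|z i0 * expi (s q * mu i0) - w| < (e p)%:C%C.
  by have [q pq uq] := cl (e p) p (e_gt0 p); exists q.
exists (s \o q), w; split => // i.
apply/cvgrPdist_lt => eps eps_gt0.
have epsE : eps = (complex.Re eps)%:C%C by rewrite RRe_real // gtr0_real.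
have {}eps_gt0 : 0 < complex.Re eps by rewrite -ltcR -epsE.
exists (Num.bound (2 / complex.Re eps)) => // p /= le_p.
have [q_ge uq] := q_lt p.
rewrite distrC -(subrKA (z i0 * expi (s (q p) * mu i0))).
apply: le_lt_trans (ler_normD _ _) _.
apply: lt_trans (ltrD (s_lt (q p) i i0) uq) _.
rewrite -rmorphD epsE ltcR.
have le_e : e (q p) <= e p by rewrite lef_pV2 ?posrE // ler_nat ltnS.
apply: (@le_lt_trans _ _ (2 / p.+1%:R)).
  by rewrite -[2]/(1 + 1) mulrDl mul1r lerD2r.
rewrite ltr_pdivrMr // mulrC -ltr_pdivrMr //.
apply: lt_trans (archi_boundP _) _; first by rewrite divr_ge0 // ltW.
by rewrite ltr_nat ltnS.
Qed.
End KroneckerSequence.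

(** * Characters *)

Lemma omega_expn (R : realType) (m : nat) : (0 < m)%N -> omega R m ^+ m = 1.
Proof.
move=> m_gt0; rewrite -expiMn -[_ *+ m]mulr_natr divfK ?pnatr_eq0 -?lt0n //.
by rewrite /expi mulr_natl cos2pi sin2pi.
Qed.

Lemma omega_expn_neq1 (R : realType) (m j : nat) :
  (0 < j < m)%N -> omega R m ^+ j != 1.
Proof.
move=> /andP[j_gt0 ltjm]; have m_gt0 := ltn_trans j_gt0 ltjm.
have pi2 : 0 < 2 * pi :> R by rewrite mulr_gt0 // pi_gt0.
have mr : 0 < m%:R :> R by rewrite ltr0n.
have x_gt0 : 0 < 2 * pi / m%:R *+ j :> R by rewrite pmulrn_lgt0 // divr_gt0.
have x_lt : `|2 * pi / m%:R *+ j| < 2 * pi :> R.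
  rewrite gtr0_norm // -[_ *+ j]mulr_natr mulrAC ltr_pdivrMr //.
  by rewrite ltr_pM2l // ltr_nat.
by rewrite -expiMn; apply: contraTneq x_gt0 => /(expi_eq1 x_lt) ->; rewrite ltxx.
Qed.

Lemma norm_omega (R : realType) (m : nat) : `|omega R m| = 1.
Proof. exact: norm_expi. Qed.

Section Characters.
Variables (R : realType) (k : nat) (n : 'I_k -> nat).
Hypothesis n_gt0 : forall j, (0 < n j)%N.
Local Notation G := (dirsum n).
Implicit Types g h : G.
Local Notation chi := (chi R).

Lemma chiC g h : chi g h = chi h g.
Proof. by apply: eq_bigr => j _; rewrite mulnC. Qed.

Lemma chiDl g g' h : chi (g + g') h = chi g h * chi g' h.
Proof.
rewrite -big_split /=; apply: eq_bigr => j _; rewrite -exprD -mulnDl ffunE /=.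
rewrite !exprM; congr (_ ^+ _).
(* Coordinates add modulo (n j).-1.+1, which is n j, the exponent that kills [omega]. *)
by apply: expr_mod; rewrite [X in _ ^+ X]prednK // omega_expn.
Qed.

Lemma chiDr g h h' : chi g (h + h') = chi g h * chi g h'.
Proof. by rewrite !(chiC g) chiDl. Qed.

Lemma norm_chi g h : `|chi g h| = 1.
Proof. by rewrite normr_prod big1 // => j _; rewrite normrX norm_omega expr1n. Qed.

Lemma chi_neq0 g h : chi g h != 0.
Proof. by rewrite -normr_eq0 norm_chi oner_eq0. Qed.

Lemma chi0 h : chi 0 h = 1.
Proof. by apply: (mulfI (chi_neq0 0 h)); rewrite -chiDl addr0 mulr1. Qed.

Lemma chi0r g : chi g 0 = 1.
Proof. by rewrite chiC chi0. Qed.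

Lemma chiNl g h : chi (- g) h = (chi g h)^-1.
Proof.
by apply: (mulfI (chi_neq0 g h)); rewrite -chiDl subrr chi0 divff ?chi_neq0.
Qed.

Lemma chiNr g h : chi g (- h) = (chi g h)^-1.
Proof. by rewrite chiC chiNl chiC. Qed.

Lemma conj_chi g h : ((chi g h)^*)%C = chi (- g) h.
Proof.
by rewrite chiNl invc_norm norm_chi expr1n invr1 mul1r.
Qed.

Lemma chi_separates h : h != 0 -> exists g, chi g h != 1.
Proof.
move=> h_neq0; have [j hj] : exists j, h j != 0.
  apply/existsP; rewrite -negb_forall; apply: contra h_neq0 => /forallP h0.
  by apply/eqP/ffunP => j; rewrite (eqP (h0 j)) ffunE.
have hj_gt0 : (0 < val (h j))%N by rewrite lt0n.
have hj_lt : (val (h j) < n j)%N by rewrite (leq_trans (ltn_ord (h j))) ?prednK.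
(* The unit vector at a nonzero coordinate of [h]; [inord 1] is truly 1, as 0 < h j < n j forces n j
   >= 2. *)
exists [ffun i => if i == j then inord 1 else 0].
rewrite /Defs.chi (bigD1 j) //= big1 => [|i ij].
  rewrite ffunE eqxx inordK; last by rewrite prednK // (leq_trans _ hj_lt).
  by rewrite mul1n mulr1 omega_expn_neq1 // hj_gt0.
by rewrite ffunE (negPf ij) /= mul0n expr0.
Qed.

Lemma sum_chi h : \sum_g chi g h = (#|{: G}| * (h == 0))%:R.
Proof.
have [->|/chi_separates[g1 g1_neq1]] := eqVneq h 0.
  by under eq_bigr do rewrite chi0r; rewrite sumr_const muln1.
rewrite muln0; have : \sum_g chi g h = chi g1 h * \sum_g chi g h.
  rewrite mulr_sumr (reindex_inj (addrI g1)) /=.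
  by apply: eq_bigr => g _; rewrite chiDl.
move/eqP; rewrite -subr_eq0 -{1}[\sum_g _]mul1r -mulrBl mulf_eq0 subr_eq0.
by rewrite eq_sym (negPf g1_neq1) => /eqP.
Qed.

Variables (S : {set G}).
Hypothesis S_sym : S = [set - s | s in S]%SET.

(** Taken in [R] so that it can serve as a frequency; [eigenvalueE] shows that the character sum is
    real. *)
Definition eigenvalue_re g : R := complex.Re (\sum_(y in S) chi g y).
Local Notation mu := eigenvalue_re.

Lemma eigenvalueN g : \sum_(y in S) chi (- g) y = \sum_(y in S) chi g y.
Proof.
rewrite {2}S_sym big_imset /=; last by move=> x y _ _; exact: oppr_inj.
by apply: eq_bigr => y _; rewrite chiNl chiNr.
Qed.

(** Conjugation replaces g by -g, which by S = -S leaves the sum unchanged. *)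
Lemma eigenvalueE g : \sum_(y in S) chi g y = (mu g)%:C%C.
Proof.
rewrite /mu RRe_real //; apply/CrealP; rewrite -[LHS]/((\sum_(y in S) chi g y)^*)%C.
rewrite rmorph_sum /= -[RHS]eigenvalueN; apply: eq_bigr => y _; exact: conj_chi.
Qed.

Lemma eigenvalue_reN g : mu (- g) = mu g.
Proof. by rewrite /mu eigenvalueN. Qed.

End Characters.

(** * Transition matrix *)

Section MatrixLimits.
Local Open Scope classical_set_scope.
Variables (U : topologicalType) (T : Type) (F : set_system T).
Hypothesis FF : Filter F.
Variables (m n : nat).
Implicit Types (M : T -> 'M[U]_(m, n)) (L : 'M[U]_(m, n)).

(** Matrix neighbourhoods are generated by boxes of entry neighbourhoods, and a filter is closed
    under the finitely many intersections involved. *)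
Lemma cvg_mxP M L :
  M @ F --> L <-> forall i j, M x i j @[x --> F] --> L i j.
Proof.
split=> [ML i j A LA|ML A [P LP PA]].
  apply: (ML [set N | A (N i j)]).
  exists (fun i' j' => [set u | (i', j') = (i, j) -> A u]) => /=.
    move=> i' j'; have [[-> ->]|ne] := eqVneq (i', j') (i, j).
      by apply: filterS LA => u Au _.
    by apply: filterE => u /eqP; rewrite (negPf ne).
  by move=> N /(_ i j) /=; apply.
apply: (@filterS _ _ _ [set x | forall ij : 'I_m * 'I_n, P ij.1 ij.2 (M x ij.1 ij.2)]).
  by move=> x Px; apply: PA => i j; exact: (Px (i, j)).
by apply: filter_forall => -[i j]; exact: (ML i j _ (LP i j)).
Qed.

End MatrixLimits.

Lemma sum_complex (R : realType) (I : Type) (r : seq I) (P : pred I) (a b : I -> R) :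
  \sum_(i <- r | P i) Complex (a i) (b i) =
  Complex (\sum_(i <- r | P i) a i) (\sum_(i <- r | P i) b i).
Proof.
by apply: (big_rec3 (fun (x : R[i]) y z => x = Complex y z)) => // i x y w _ ->.
Qed.

(** Euler's formula: i^p is real for even p and imaginary for odd p, so the partial sums split into
    those of cosine and sine. *)
Lemma cvg_series_expi (R : realType) (x : R) :
  (series (fun p => (p`!%:R)^-1 * ('i%C * x%:C%C) ^+ p : R[i]) @ \oo --> expi x)%classic.
Proof.
have -> : (fun p => (p`!%:R)^-1 * ('i%C * x%:C%C) ^+ p : R[i]) =
    fun p => Complex (cos_coeff x p) (sin_coeff x p).
  apply/funext => p; rewrite exprMn.
  have -> : 'i%C ^+ p =
      Complex ((~~ odd p)%:R * (-1) ^+ p./2) ((odd p)%:R * (-1) ^+ p.-1./2) :> R[i].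
    rewrite -[p in LHS]odd_double_half -muln2 mulnC exprD exprM sqr_i.
    have -> : (-1 : R[i]) ^+ p./2 = ((-1) ^+ p./2)%:C%C by rewrite rmorphXn rmorphN1.
    case odd_p : (odd p) => /=.
      rewrite mul0r mul1r; have -> : (p.-1./2 = p./2)%N.
        by rewrite -[p in LHS]odd_double_half odd_p /= doubleK.
      by apply/eqP; rewrite eq_complex /=; apply/andP; split; apply/eqP => /=; ring.
    by apply/eqP; rewrite eq_complex /= ; apply/andP; split; apply/eqP; ring.
  have -> : (p`!%:R : R[i])^-1 = ((p`!%:R)^-1)%:C%C by rewrite fmorphV rmorph_nat.
  rewrite -rmorphXn /cos_coeff /sin_coeff /=.
  apply/eqP; rewrite eq_complex /=; apply/andP; split; apply/eqP;
    rewrite -?exprnP; ring.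
have -> : series (fun p => Complex (cos_coeff x p) (sin_coeff x p)) =
    fun N => Complex (series (cos_coeff x) N) (series (sin_coeff x) N).
  by apply/funext => N; rewrite /series /= sum_complex.
apply: cvg_complex; rewrite unlock.
  exact: is_cvg_series_cos_coeff.
exact: is_cvg_series_sin_coeff.
Qed.

Lemma exprSmx (C : pzSemiRingType) (m : nat) (A : 'M[C]_m) (p : nat) :
  A ^+ p.+1 = A *m A ^+ p.
Proof. exact: exprS. Qed.

Lemma exprZmx (C : comPzRingType) (m : nat) (c : C) (A : 'M[C]_m) (p : nat) :
  (c *: A) ^+ p = c ^+ p *: A ^+ p.
Proof.
elim: p => [|p IH]; first by rewrite !expr0 scale1r.
by rewrite !exprSmx IH exprS -scalemxAl -scalemxAr scalerA.
Qed.

Section Transition.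
Local Open Scope classical_set_scope.

Lemma cvg_fsum (K : numFieldType) (V : normedModType K) (T : Type) (F : set_system T)
    (I : finType) (f : I -> T -> V) (l : I -> V) :
  Filter F -> (forall i, f i x @[x --> F] --> l i) ->
  \sum_i f i x @[x --> F] --> \sum_i l i.
Proof. by move=> FF fl; apply: cvg_big => //; exact: add_continuous. Qed.

(** Since [expmx] is a [limn], convergence of the matrix series is established first; uniqueness of
    limits is then applied entry by entry. *)
Lemma expmx_entry (R : realType) (m : nat) (A L : 'M[R[i]]_m) :
  (forall i j, series (fun p : nat => (p`!%:R)^-1 * (A ^+ p) i j) @ \oo --> L i j) ->
  expmx A = L.
Proof.
move=> AL.
have cvgA : series (fun p : nat => (p`!%:R : R[i])^-1 *: A ^+ p) @ \oo --> L.
  apply/cvg_mxP => i j; apply: cvg_trans (AL i j); apply: near_eq_cvg.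
  by apply: nearW => N; rewrite /series /= summxE; apply: eq_bigr => p _; rewrite mxE.
have /cvgP/cvg_mxP cvg_lim := cvgA.
apply/matrixP => i j; have /cvg_mxP/(_ i j) := cvgA.
have := cvg_lim i j.
exact: (@cvg_unique _ (@norm_hausdorff _ R[i])).
Qed.

Variables (R : realType) (k : nat) (n : 'I_k -> nat).
Hypothesis n_gt0 : forall j, (0 < n j)%N.
Local Notation G := (dirsum n).
Local Notation chi := (chi R).
Variables (S : {set G}).
Hypothesis S_sym : S = [set - s | s in S]%SET.
Hypothesis S_0 : 0 \notin S.
Local Notation mu := (eigenvalue_re R S).

Let card_neq0 : (#|{: G}|%:R : R[i]) != 0.
Proof. by rewrite pnatr_eq0 -lt0n; apply/card_gt0P; exists 0. Qed.

(** Spectral decomposition of the powers: p = 0 is orthogonality of characters, and each further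
    factor contributes one eigenvalue. *)
Lemma adjmx_expE p i j : (adjmx R (cayley S) ^+ p) i j =
  (#|{: G}|%:R)^-1 * \sum_g (mu g)%:C%C ^+ p * chi g (enum_val i - enum_val j).
Proof.
elim: p i => [|p IH] i.
  under eq_bigr do rewrite expr0 mul1r.
  rewrite sum_chi // subr_eq0 (inj_eq enum_val_inj) expr0 mxE natrM mulKf //.
rewrite exprSmx mxE.
under eq_bigr do rewrite IH mxE mulrCA.
rewrite -mulr_sumr; congr (_ * _).
rewrite (reindex (@enum_rank G)) /=; last by apply: onW_bij; exact: enum_rank_bij.
under eq_bigr do rewrite enum_rankK mulr_sumr.
rewrite exchange_big; apply: eq_bigr => g _ /=.
(* Writing the neighbour as i + y turns adjacency into y in [S], since 0 is not in [S]. *)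
rewrite (reindex_inj (addrI (enum_val i))) /=.
under eq_bigr => y _.
  rewrite /cayley /= addrAC subrr add0r.
  rewrite (_ : _ && _ = (y \in S)); last first.
    case yS : (y \in S); rewrite ?andbF // andbT.
    by apply: contraTneq yS => /esym/(canRL (addKr _)); rewrite addNr => ->.
  rewrite -addrAC chiDr // mulrCA [X in _ * X]mulrCA.
  over.
rewrite -mulr_sumr exprSr -[RHS]mulrA; congr (_ * _).
rewrite -mulr_sumr mulrC -eigenvalueE //; congr (_ * _).
rewrite [RHS]big_mkcond; apply: eq_bigr => y _.
by case: (y \in S); rewrite ?mul1r ?mul0r.
Qed.

Lemma transmxE t i j : transmx (cayley S) t i j =
  (#|{: G}|%:R)^-1 * \sum_g expi (- (t * mu g)) * chi g (enum_val i - enum_val j).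
Proof.
pose L : 'M[R[i]]_#|{: G}| := \matrix_(i, j) ((#|{: G}|%:R)^-1 *
  \sum_g expi (- (t * mu g)) * chi g (enum_val i - enum_val j)).
suff -> : transmx (cayley S) t = L by rewrite mxE.
apply: expmx_entry => {}i {}j; rewrite mxE.
pose c g : R[i] := 'i%C * (- (t * mu g))%:C%C.
have -> : series (fun p =>
      (p`!%:R)^-1 * (((- ('i * t%:C%C)) *: adjmx R (cayley S)) ^+ p) i j) =
    fun N => (#|{: G}|%:R)^-1 * \sum_g
      series (fun p => (p`!%:R)^-1 * c g ^+ p) N * chi g (enum_val i - enum_val j).
  apply/funext => N; rewrite /series /=.
  under eq_bigr do rewrite exprZmx mxE adjmx_expE 2!(mulrCA _ (#|{: G}|%:R)^-1).
  rewrite -mulr_sumr; congr (_ * _).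
  under [LHS]eq_bigr => p _ do rewrite mulrA mulr_sumr.
  rewrite exchange_big /=; apply: eq_bigr => g _.
  rewrite mulr_suml; apply: eq_bigr => p _.
  rewrite mulrA -[X in X * _ = _]mulrA -exprMn; congr (_ * _ ^+ _ * _).
  by rewrite /c complexiE rmorphN rmorphM mulNr mulrN mulrA.
apply: cvgMl_tmp; apply: cvg_fsum => g.
by apply: cvgMr_tmp; exact: cvg_series_expi.
Qed.

Lemma chi_orthogonal (a : G) g g' :
  \sum_x chi g (a - x) * chi g' (x - a) = (#|{: G}| * (g' == g))%:R.
Proof.
rewrite -subr_eq0 -(sum_chi R n_gt0 (g' - g)) (reindex_inj (addIr a)) /=.
apply: eq_bigr => x _; rewrite addrK opprD addrCA subrr addr0.
by rewrite chiNr // -chiNl // -chiDl // addrC chiC.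
Qed.

Lemma fourier_inversion (h : G -> R[i]) (a : G) g :
  \sum_x chi g (a - x) * ((#|{: G}|%:R)^-1 * \sum_g' h g' * chi g' (x - a)) = h g.
Proof.
transitivity ((#|{: G}|%:R)^-1 *
    \sum_g' h g' * \sum_x chi g (a - x) * chi g' (x - a)).
  under eq_bigr do rewrite mulrCA.
  rewrite -mulr_sumr; congr (_ * _).
  under eq_bigr => x _ do rewrite mulr_sumr.
  rewrite exchange_big; apply: eq_bigr => g' _; rewrite mulr_sumr.
  by apply: eq_bigr => x _; rewrite mulrCA.
under eq_bigr do rewrite chi_orthogonal.
rewrite (bigD1 g) //= big1 => [|g' /negPf ->]; last by rewrite muln0 mulr0.
by rewrite eqxx muln1 addr0 mulrCA mulVf // mulr1.
Qed.

(** The entries of H(t) e_a are the inverse Fourier transform of exp(-i t mu g), and al e_a + be e_b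
    has transform al + be chi_g(a - b). Both transforms are finite sums, so limits pass through them
    in either direction. *)
Lemma PGFR_cayleyP (a b : G) :
  PGFR R (cayley S) a b <-> exists (t : nat -> R) (al be : R[i]),
    [/\ forall g, expi (- (t p * mu g)) @[p --> \oo] --> al + be * chi g (a - b),
        be != 0 & `|al| ^+ 2 + `|be| ^+ 2 = 1].
Proof.
have evecE x y i : (x *: evec R a + y *: evec R b) i 0 =
    x * (enum_val i == a)%:R + y * (enum_val i == b)%:R.
  by rewrite !mxE !eqxx !andbT -!(inj_eq enum_val_inj) !enum_rankK.
have HE t x : (transmx (cayley S) t *m evec R a) (enum_rank x) 0 =
    (#|{: G}|%:R)^-1 * \sum_g expi (- (t * mu g)) * chi g (x - a).
  by rewrite -colE mxE transmxE !enum_rankK.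
split=> -[t [al [be [H be_neq0 norm1]]]]; exists t, al, be; split=> //.
  move=> g; move/cvg_mxP: H => H.
  have {}H x := H (enum_rank x) 0.
  have -> : (fun p => expi (- (t p * mu g))) = fun p =>
    \sum_x chi g (a - x) * (transmx (cayley S) (t p) *m evec R a) (enum_rank x) 0.
    apply/funext => p; under eq_bigr do rewrite HE.
    by rewrite (fourier_inversion (fun g => expi (- (t p * mu g)))).
  have -> : al + be * chi g (a - b) =
    \sum_x chi g (a - x) * (al *: evec R a + be *: evec R b) (enum_rank x) 0.
    under eq_bigr do rewrite evecE enum_rankK mulrDr.
    rewrite big_split /= (bigD1 a) //= big1 => [|x /negPf ->]; last by rewrite !mulr0.
    rewrite [X in _ = _ + X](bigD1 b) //= big1 => [|x /negPf ->]; last by rewrite !mulr0.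
    by rewrite !eqxx !mulr1 !addr0 subrr chi0r // mul1r mulrC.
  by apply: cvg_fsum => x; apply: cvgMl_tmp.
apply/cvg_mxP => i j; rewrite (ord1 j) -(enum_valK i).
move: (enum_val i) => x.
under eq_fun do rewrite HE.
have -> : (al *: evec R a + be *: evec R b) (enum_rank x) 0 =
    (#|{: G}|%:R)^-1 * \sum_g (al + be * chi g (a - b)) * chi g (x - a).
  rewrite evecE enum_rankK.
  have abx : a - b + (x - a) = x - b by rewrite [LHS]addrC addrA subrK.
  under eq_bigr => g _.
    rewrite mulrDl -mulrA -chiDr // abx.
    over.
  rewrite big_split /= -!mulr_sumr !sum_chi // !subr_eq0 !natrM.
  by rewrite mulrDr; congr (_ + _); rewrite [RHS]mulrCA mulKf.
apply: cvgMl_tmp; apply: cvg_fsum => g; apply: cvgMr_tmp; exact: H.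
Qed.
End Transition.

(** * Fractional revival *)

(** [H] is a subgroup of the integers, and its least positive element is the divisor sought. *)
Lemma int_common_divisor (H : int -> Prop) :
  H 0 -> (forall m m' q, H m -> H m' -> H (m - q * m')) -> ~ H 1 ->
  exists2 d : nat, (1 < d)%N & forall m, H m -> (d %| m)%Z.
Proof.
move=> H0 HB notH1.
pose pos d := (0 < d)%N && `[< H d%:Z >].
have [posH|noH] := pselect (exists d, pos d); last first.
  (* Without positive elements [H] contains only 0, which every d divides. *)
  exists 2%N => // m Hm.
  have Habs : H `|m|%N%:Z.
    case: (intP m) Hm => // d Hd; rewrite abszN.
    by have := HB 0 _ 1 H0 Hd; rewrite mul1r add0r opprK.
  have [/eqP|m_gt0] := posnP `|m|%N; first by rewrite absz_eq0 => /eqP ->.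
  by case: noH; exists `|m|%N; rewrite /pos m_gt0; apply/asboolP.
have [d /andP[d_gt0 /asboolP Hd] d_min] := ex_minnP posH.
exists d => [|m Hm].
  rewrite ltn_neqAle d_gt0 andbT; apply/eqP => d1.
  by apply: notH1; rewrite -[1]/(1%N%:Z) d1.
apply/dvdz_mod0P; apply/eqP; apply: contraT => mod_neq0.
have d_neq0 : d%:Z != 0 by rewrite eqz_nat -lt0n.
have mod_ge0 := modz_ge0 m d_neq0.
have mod_lt : (m %% d)%Z < d by rewrite ltz_pmod // ltz_nat.
have modE : (m %% d)%Z = `|(m %% d)%Z|%N%:Z by rewrite gez0_abs.
(* A nonzero remainder would be a positive element of [H] smaller than [d]. *)
have : (d <= `|(m %% d)%Z|)%N.
  apply: d_min; rewrite /pos absz_gt0 mod_neq0; apply/asboolP; rewrite -modE /modz.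
  exact: HB.
by rewrite -lez_nat -modE leNgt mod_lt.
Qed.

Lemma cvg_expiMz (R : realType) (x : nat -> R) (u : R[i]) (l : int) : u != 0 ->
  (expi (x p) @[p --> \oo] --> u)%classic ->
  (expi (x p *~ l) @[p --> \oo] --> u ^ l)%classic.
Proof.
move=> u_neq0 xu.
have nat_case (m : nat) : (expi (x p *+ m) @[p --> \oo] --> u ^+ m)%classic.
  elim: m => [|m IH].
    by rewrite expr0; under eq_fun do rewrite mulr0n expi0; exact: cvg_cst.
  rewrite exprS; under eq_fun do rewrite mulrS expiD.
  exact: (cvgM xu IH).
case: (intP l) => [|m|m]; [exact: (nat_case 0%N) | exact: (nat_case m.+1)|].
rewrite -exprnN; under eq_fun do rewrite mulrNz expiN.
exact: (cvgV (expf_neq0 m.+1 u_neq0) (nat_case m.+1)).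
Qed.

Lemma cvg_fprod (K : numFieldType) (T : Type) (F : set_system T)
    (I : finType) (P : pred I) (f : I -> T -> K) (l : I -> K) :
  Filter F -> (forall i, P i -> f i x @[x --> F] --> l i)%classic ->
  (\prod_(i | P i) f i x @[x --> F] --> \prod_(i | P i) l i)%classic.
Proof. by move=> FF fl; apply: cvg_big => //; exact: mul_continuous. Qed.

Lemma dirsum_order2P (k : nat) (n : 'I_k -> nat) (d : dirsum n) :
  #[d]%g = 2%N <-> d != 0 /\ d + d = 0.
Proof.
split=> [d2|[d_neq0 dd]].
  split; last by have := expg_order d; rewrite d2.
  by apply/eqP => d0; have := order1 (dirsum n); rewrite -[X in #[X]%g]/(0 : dirsum n) -d0 d2.
have d_neq1 : #[d]%g != 1%N by rewrite order_eq1.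
apply/(prime_nt_dvdP (isT : prime 2) d_neq1); rewrite order_dvdn.
by apply/eqP; exact: dd.
Qed.

Lemma chi_order2 (R : realType) (k : nat) (n : 'I_k -> nat) (g d : dirsum n) :
  (forall j, (0 < n j)%N) -> d + d = 0 -> chi R g d = if chi R g d == -1 then -1 else 1.
Proof.
move=> n_gt0 dd; case: ifP => [/eqP //|chi_neqN1].
have : chi R g d ^+ 2 == 1 ^+ 2 by rewrite expr2 -chiDr // dd chi0r // expr1n.
by rewrite eqf_sqr chi_neqN1 orbF => /eqP.
Qed.

Lemma cvgC_unique (R : realType) (u : nat -> R[i]) (x y : R[i]) :
  (u @ \oo --> x -> u @ \oo --> y -> x = y)%classic.
Proof. exact: (@cvg_unique _ (@norm_hausdorff _ R[i])). Qed.

Section FractionalRevival.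
Variables (R : realType) (k : nat) (n : 'I_k -> nat).
Hypothesis n_gt0 : forall j, (0 < n j)%N.
Local Notation G := (dirsum n).
Local Notation chi := (chi R).
Variables (S : {set G}).
Hypothesis S_sym : S = [set - s | s in S]%SET.
Hypothesis S_0 : 0 \notin S.
Local Notation mu := (eigenvalue_re R S).
Variables (a b : G).

(** Equal eigenvalues at g and -g give equal limits, so chi_g(a - b) is its own inverse for all g;
    characters separate points. *)
Lemma PGFR_add_self : a <> b -> PGFR R (cayley S) a b -> (b - a) + (b - a) = 0.
Proof.
move=> ab /(PGFR_cayleyP R n_gt0 S_sym S_0)[t [al [be [H be_neq0 _]]]].
have chiN g : chi (- g) (a - b) = chi g (a - b).
  apply: (mulfI be_neq0); apply: (addrI al).
  apply: cvgC_unique (H g); under eq_fun do rewrite -(eigenvalue_reN R n_gt0 S_sym).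
  exact: H.
apply/eqP; apply: contraT => /(chi_separates R n_gt0)[g].
rewrite chiDr // -[in X in X * _](opprB a b) chiNr // -chiNl // chiN -chiDr //.
by rewrite addrA subrK subrr chi0r // eqxx.
Qed.

Variables (I : finType) (a_ : I -> G) (a_bij : bijective a_) (i0 : I).
Hypothesis a_0 : a_ i0 = 0.
Hypothesis dd : (b - a) + (b - a) = 0.
Let X2 := [set r : I | chi (a_ r) (b - a) == -1]%SET.

Let i0_X2 : i0 \notin X2.
Proof.
rewrite inE a_0 chi0 //; apply/eqP => /(congr1 (@complex.Re R)) /=; lra.
Qed.

Let revival_amplitude (al be : R[i]) r :
  al + be * chi (a_ r) (a - b) = if r \in X2 then al - be else al + be.
Proof.
rewrite -(opprB b a) chiNr // (chi_order2 R (a_ r) n_gt0 dd) inE.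
by case: ifP; rewrite ?invrN invr1 ?mulrN mulr1.
Qed.

(** Here zeta = (al - be) / (al + be). The form zeta^sum = 1 excludes the sums 1 and -1 alike. *)
Lemma PGFR_relation (l : I -> int) : PGFR R (cayley S) a b ->
  \sum_(r | r != i0) (mu (a_ r) - mu (a_ i0)) *~ l r = 0 ->
  exists2 zeta : R[i], zeta != 1 & zeta ^ (\sum_(r in X2) l r) = 1.
Proof.
move=> /(PGFR_cayleyP R n_gt0 S_sym S_0)[t [al [be [H be_neq0 _]]]] rel.
have lim r := H (a_ r).
have {}lim r : (expi (- (t p * mu (a_ r))) @[p --> \oo] -->
    if r \in X2 then al - be else al + be)%classic.
  by rewrite -revival_amplitude.
have norm_lim r : `|if r \in X2 then al - be else al + be| = 1.
  have /cvg_norm := lim r; under eq_fun do rewrite norm_expi.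
  by move=> h; apply: cvgC_unique h _; exact: cvg_cst.
have neq0 r : (if r \in X2 then al - be else al + be) != 0.
  by rewrite -normr_eq0 norm_lim oner_eq0.
have sum_neq0 : al + be != 0 by have := neq0 i0; rewrite (negPf i0_X2).
have lim0 : ((expi (- (t p * mu (a_ i0))))^-1 @[p --> \oo] --> (al + be)^-1)%classic.
  by have := lim i0; rewrite (negPf i0_X2) => /(cvgV sum_neq0).
(* Dividing by the phase at [i0] produces the frequency differences that occur in the relation. *)
have limq r : (expi (- (t p * (mu (a_ r) - mu (a_ i0)))) @[p --> \oo] -->
    if r \in X2 then (al - be) / (al + be) else 1)%classic.
  have -> : (fun p => expi (- (t p * (mu (a_ r) - mu (a_ i0))))) =
      fun p => expi (- (t p * mu (a_ r))) * (expi (- (t p * mu (a_ i0))))^-1.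
    by apply/funext => p; rewrite -expiN -expiD; congr expi; ring.
  have -> : (if r \in X2 then (al - be) / (al + be) else 1) =
      (if r \in X2 then al - be else al + be) * (al + be)^-1.
    by case: ifP => _; rewrite ?divff.
  exact: (cvgM (lim r) lim0).
have q_neq0 r : (if r \in X2 then (al - be) / (al + be) else 1) != 0.
  have := neq0 r; case: ifP => _ h; rewrite ?oner_eq0 //.
  by rewrite mulf_neq0 ?invr_eq0.
have limP : (\prod_(r | r != i0) expi ((- (t p * (mu (a_ r) - mu (a_ i0)))) *~ l r)
    @[p --> \oo] --> \prod_(r | r != i0)
      (if r \in X2 then (al - be) / (al + be) else 1) ^ l r)%classic.
  by apply: cvg_fprod => r _; exact: (cvg_expiMz (q_neq0 r) (limq r)).
(* The relation makes the total phase vanish at every time, so the limit of the products is 1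
   too. *)
have prod1 p : \prod_(r | r != i0) expi ((- (t p * (mu (a_ r) - mu (a_ i0)))) *~ l r) = 1.
  rewrite -(big_morph (@expi R) (@expiD R) (expi0 R)).
  rewrite -[RHS](expi0 R); congr expi.
  transitivity (- t p * \sum_(r | r != i0) (mu (a_ r) - mu (a_ i0)) *~ l r).
    rewrite mulr_sumr; apply: eq_bigr => r _.
    by rewrite mulrzAr mulNr.
  by rewrite rel mulr0.
have {limP prod1}: \prod_(r | r != i0)
    (if r \in X2 then (al - be) / (al + be) else 1) ^ l r = 1.
  apply: cvgC_unique limP _; under eq_fun do rewrite prod1.
  exact: cvg_cst.
rewrite (bigID (mem X2)) /= [X in _ * X]big1; last first.
  by move=> r /andP[_ /negPf ->]; rewrite exp1rz.
rewrite mulr1 => prod1; exists ((al - be) / (al + be)).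
  apply/eqP => /(congr1 ( *%R^~ (al + be))); rewrite divfK // mul1r => /addrI/eqP.
  by rewrite -subr_eq0 -opprD oppr_eq0 -mulr2n mulrn_eq0 (negPf be_neq0).
(* An element of [X2] shows zeta to be nonzero; if [X2] is empty, the sum is 0. *)
have [r rX2|X20] := pickP [in X2]; last by rewrite big_pred0 ?expr0z.
have zeta_neq0 : (al - be) / (al + be) != 0.
  by have := q_neq0 r; rewrite [r \in X2]rX2.
rewrite (big_morph (fun m : int => ((al - be) / (al + be)) ^ m)
  (fun x y => expfzDr x y zeta_neq0) (expr0z _)).
rewrite -[RHS]prod1; apply: eq_big => [i|i ->//].
by rewrite andb_idl // => iX2; apply: contraNneq i0_X2 => <-.
Qed.

(** Equal total weights cancel the terms in mu (a_ i0), so c - c' is an integer relation between the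
    differences. The sign of the frequencies is that of H(t) = exp(-i t A). *)
Let lattice_relation (c c' : I -> nat) :
  (\sum_i c i = \sum_i c' i)%N ->
  \sum_i - mu (a_ i) *+ c i = \sum_i - mu (a_ i) *+ c' i ->
  \sum_(r | r != i0) (mu (a_ r) - mu (a_ i0)) *~ ((c r)%:Z - (c' r)%:Z) = 0.
Proof.
move=> sum_cc' sum_mu.
have -> : \sum_(r | r != i0) (mu (a_ r) - mu (a_ i0)) *~ ((c r)%:Z - (c' r)%:Z) =
    \sum_r (mu (a_ r) - mu (a_ i0)) *~ ((c r)%:Z - (c' r)%:Z).
  by rewrite [RHS](bigD1 i0) //= subrr mul0rz add0r.
have -> : \sum_r (mu (a_ r) - mu (a_ i0)) *~ ((c r)%:Z - (c' r)%:Z) =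
    (\sum_r - mu (a_ r) *+ c' r - \sum_r - mu (a_ r) *+ c r)
      - (mu (a_ i0) *+ (\sum_r c r) - mu (a_ i0) *+ (\sum_r c' r)).
  rewrite -!sumrMnr -!sumrB; apply: eq_bigr => r _.
  by rewrite mulrzBr -!pmulrn !mulrnBl !mulNrn; ring.
by rewrite sum_cc' sum_mu !subrr.
Qed.

Lemma PGFR_of_common_divisor (d : nat) : (1 < d)%N ->
  (forall l : I -> int,
     \sum_(r | r != i0) (mu (a_ r) - mu (a_ i0)) *~ l r = 0 ->
     (d %| \sum_(r in X2) l r)%Z) ->
  PGFR R (cayley S) a b.
Proof.
move=> d_gt1 d_dvd.
have zeta_d : omega R d ^+ d = 1 by rewrite omega_expn // ltnW.
have zeta_neq1 : omega R d != 1 by rewrite -(expr1 (omega R d)) omega_expn_neq1.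
have zeta_neq0 : omega R d != 0 by exact: expi_neq0.
set zeta := omega R d in zeta_d zeta_neq1 zeta_neq0.
pose z r := if r \in X2 then zeta else 1.
have norm_z r : `|z r| = 1 by rewrite /z; case: ifP; rewrite ?norm_omega ?normr1.
have z_prod (c : I -> nat) : \prod_r z r ^+ c r = zeta ^+ (\sum_(r in X2) c r).
  rewrite -prodrXr [RHS]big_mkcond /=; apply: eq_bigr => r _.
  by rewrite /z; case: ifP => // _; rewrite expr1n.
have z_compat (c c' : I -> nat) : (\sum_i c i = \sum_i c' i)%N ->
    \sum_i - mu (a_ i) *+ c i = \sum_i - mu (a_ i) *+ c' i ->
    \prod_i z i ^+ c i = \prod_i z i ^+ c' i.
  move=> sum_cc' /(lattice_relation sum_cc')/d_dvd.
  (* The two sums over [X2] agree modulo [d], and zeta^d = 1. *)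
  rewrite sumrB -!(big_morph Posz PoszD (erefl _)) -eqz_mod_dvd !modz_nat => /eqP[modE].
  by rewrite !z_prod -(expr_mod _ zeta_d) modE expr_mod.
have [t [w [norm_w lim]]] := kronecker_seq norm_z z_compat i0.
apply/(PGFR_cayleyP R n_gt0 S_sym S_0).
(* The solution of al + be = w and al - be = w / zeta, the limits required off and on [X2]. *)
exists t, (w * (1 + zeta^-1) / 2), (w * (1 - zeta^-1) / 2).
have two_neq0 : (2 : R[i]) != 0 by rewrite pnatr_eq0.
split.
- move=> g; have [a_inv _ a_invK] := a_bij.
  rewrite -(a_invK g) revival_amplitude.
  have -> : (if a_inv g \in X2 then w * (1 + zeta^-1) / 2 - w * (1 - zeta^-1) / 2
             else w * (1 + zeta^-1) / 2 + w * (1 - zeta^-1) / 2) =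
            (z (a_inv g))^-1 * w.
    by rewrite /z; case: ifP => _; rewrite ?invr1; field.
  have -> : (fun p => expi (- (t p * mu (a_ (a_inv g))))) = fun p =>
      (z (a_inv g))^-1 * (z (a_inv g) * expi (t p * - mu (a_ (a_inv g)))).
    apply/funext => p; rewrite mulKf ?mulrN //.
    by rewrite -normr_eq0 norm_z oner_eq0.
  by apply: cvgMl_tmp; exact: lim.
- have w_neq0 : w != 0 by rewrite -normr_eq0 norm_w oner_eq0.
  rewrite mulf_neq0 ?invr_eq0 // mulf_neq0 // subr_eq0 eq_sym.
  by rewrite invr_eq1.
- have norm_zetaV : `|zeta^-1| = 1 by rewrite normfV norm_omega invr1.
  rewrite !normrM norm_w !mul1r !exprMn -mulrDl normfV normr_nat !sqr_normc.
  rewrite !rmorphD rmorphN rmorph1 /=.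
  have -> : (1 + zeta^-1) * (1 + (zeta^-1)^*%C) + (1 - zeta^-1) * (1 - (zeta^-1)^*%C)
     = 2 * (1 + zeta^-1 * (zeta^-1)^*%C) by ring.
  by rewrite -sqr_normc norm_zetaV expr1n; field.
Qed.

End FractionalRevival.

Unset Implicit Arguments.

Theorem theorem3p4 (R : realType) (k : nat) (n : 'I_k -> nat)
    (n_gt0 : forall j, (0 < n j)%N)
    (N : nat) (order_G : N.+1 = (\prod_(j < k) n j)%N)
    (a_ : 'I_N.+1 -> dirsum n) (a_bij : bijective a_) (a_0 : a_ ord0 = 0)
    (S : {set dirsum n}) (S_0 : 0 \notin S) (S_sym : S = [set - s | s in S]%SET)
    (a b : dirsum n) (a_neq_b : a <> b) :
  let lambda := fun r : 'I_N.+1 => \sum_(y in S) chi R (a_ r) y in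
  let X2 := [set r : 'I_N.+1 | chi R (a_ r) (b - a) == -1]%SET in
  PGFR R (cayley S) a b <->
    (~~ odd N.+1 /\ #[b - a]%g = 2%N) /\
    (forall l : 'I_N.+1 -> int,
       \sum_(r < N.+1 | r != ord0) (lambda r - lambda ord0) *~ l r = 0 ->
       \sum_(r in X2) l r <> 1 /\ \sum_(r in X2) l r <> -1).
Proof.
move=> lambda X2.
(* Relations between the complex eigenvalues are the same as relations between their real parts. *)
have lambdaE (l : 'I_N.+1 -> int) :
    \sum_(r < N.+1 | r != ord0) (lambda r - lambda ord0) *~ l r =
    (\sum_(r < N.+1 | r != ord0)
      (eigenvalue_re R S (a_ r) - eigenvalue_re R S (a_ ord0)) *~ l r)%:C%C.
  rewrite rmorph_sum; apply: eq_bigr => r _.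
  by rewrite /lambda !eigenvalueE // rmorphMz rmorphB.
have card_G : #|{: dirsum n}| = N.+1 by rewrite -(bij_eq_card a_bij) card_ord.
split=> [revival|[[_ /dirsum_order2P[_ dd]] rel]].
  have dd := PGFR_add_self n_gt0 S_sym S_0 a_neq_b revival.
  have order2 : #[b - a]%g = 2%N.
    by apply/dirsum_order2P; split=> //; rewrite subr_eq0; apply/eqP => /esym.
  split; first split=> //.
    (* By Lagrange, the order 2 of b - a divides that of the group. *)
    by rewrite -dvdn2 -order2 -card_G -cardsT; apply: order_dvdG; rewrite inE.
  move=> l; rewrite lambdaE => /(@complexI _ _ 0) rel.
  have [zeta zeta_neq1 zeta_sum] :=
    PGFR_relation n_gt0 S_sym S_0 a_0 dd revival rel.
  split=> sum_l; move: zeta_sum; rewrite sum_l.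
    by move/eqP; apply/negP.
  by move/eqP; rewrite -[_ ^ _]/(zeta^-1) invr_eq1; apply/negP.
(* The values on [X2] of all relations; condition (ii) says that 1 is not among them. *)
pose H m := exists2 l : 'I_N.+1 -> int,
  \sum_(r < N.+1 | r != ord0)
    (eigenvalue_re R S (a_ r) - eigenvalue_re R S (a_ ord0)) *~ l r = 0 &
  \sum_(r in X2) l r = m.
have [d d_gt1 d_dvd] : exists2 d : nat, (1 < d)%N & forall m, H m -> (d %| m)%Z.
  apply: int_common_divisor.
  - by exists (fun=> 0); rewrite big1 // => r _; rewrite mulr0z.
  - move=> m m' q [l rel_l <-] [l' rel_l' <-]; exists (fun r => l r - q * l' r).
      under eq_bigr do rewrite mulrzBr [q * _]mulrC mulrzA.
      by rewrite sumrB rel_l -mulrz_suml rel_l' mul0rz subrr.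
    by rewrite sumrB mulr_sumr.
  - by move=> [l rel_l sum_l]; have [] := rel l; rewrite ?lambdaE ?rel_l.
apply: (PGFR_of_common_divisor n_gt0 S_sym S_0 a_bij (i0 := ord0) dd d_gt1) => l rel_l.
by apply: d_dvd; exists l.
Qed.
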